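(* Let $t$ be a line of $\mathbb{P}^2_{\mathbb{C}}$ (denote by $t$ also a linear form defining it). \begin{itemize} \item If $t$ is not tangent to $\mathcal{Q}_{\mathrm{iso}}$, then for a cubic $C=V(f)$ one has $t\subseteq E(f)$ if and only if $f=t^2\ell$, where $\ell$ is any linear form. \item If $t$ is tangent to $\mathcal{Q}_{\mathrm{iso}}$ at a point $P$, fix any line $r_0\neq t$ passing through $P$. Then for a cubic $C=V(f)$ one has $t\subseteq E(f)$ if and only if \[ f=t^2\ell+\lambda f(r_0) \] for some linear form $\ell$ (possibly zero) and some $\lambda\in\mathbb{C}$. \end{itemize} Moreover, if $t$ is tangent to $\mathcal{Q}_{\mathrm{iso}}$ at $P$ and $r_0\neq t$ is a line passing through $P$, every cubic $V(f)$ with $f=t^2\ell+\lambda f(r_0)$, where $\ell$ is a linear form (possibly zero) and $\lambda\in\mathbb{C}$, is singular at $P$; and if such a $V(f)$ is irreducible, then $V(f)$ is nodal and the line $t$ belongs to the tangent cone of $V(f)$ at $P$.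
   Context: $\mathcal{Q}_{\mathrm{iso}}$ denotes the conic $x^2+y^2+z^2=0$ and also its defining polynomial. For a nonzero ternary cubic form $f\in\mathbb{C}[x,y,z]_3$, the eigenscheme $E(f)\subset\mathbb{P}^2_{\mathbb{C}}$ is the subscheme defined by the $2\times2$ minors of $\begin{pmatrix}x&y&z\\ \partial_xf&\partial_yf&\partial_zf\end{pmatrix}$. For a line $r=ax+by+cz$ meeting $\mathcal{Q}_{\mathrm{iso}}$ in two distinct points, $f(r)$ denotes the cubic form \[ f(r)=\bigl(r^2-3(a^2+b^2+c^2)\,\mathcal{Q}_{\mathrm{iso}}\bigr)\,r . \] Cubics $V(f)$ always have $f\ne0$. *)

(* Defs.v *)
From mathcomp Require Import all_boot all_order all_algebra.
From mathcomp Require Export reals complex mpoly.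

Set Implicit Arguments.
Unset Strict Implicit.
Unset Printing Implicit Defensive.

Import GRing.Theory.
Local Open Scope ring_scope.

(* The homogeneous coordinates x, y, z are 'X_0, 'X_1, 'X_2 in {mpoly K[3]};
   a point of the projective plane is given by a nonzero row vector. *)

Definition linear_form (K : closedFieldType) (l : {mpoly K[3]}) : Prop :=
  l \is 1.-homog.

Definition is_line (K : closedFieldType) (l : {mpoly K[3]}) : Prop :=
  linear_form l /\ l != 0.

Definition same_line (K : closedFieldType) (l1 l2 : {mpoly K[3]}) : Prop :=
  exists2 c : K, c != 0 & l1 = c *: l2.

Definition is_cubic (K : closedFieldType) (f : {mpoly K[3]}) : Prop :=
  f \is 3.-homog /\ f != 0.

(* A subscheme of the projective plane is represented by a homogeneous ideal J
   of K[x,y,z].  Two ideals define the same subscheme iff they have the same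
   saturation with respect to (x,y,z), and Proj(S/J1) is contained in
   Proj(S/J2) iff J2 lies in the saturation of J1. *)

Definition ideal_gen (K : closedFieldType) (I : finType)
    (g : I -> {mpoly K[3]}) (p : {mpoly K[3]}) : Prop :=
  exists c : I -> {mpoly K[3]}, p = \sum_(k : I) c k * g k.

Definition saturation (K : closedFieldType) (J : {mpoly K[3]} -> Prop)
    (p : {mpoly K[3]}) : Prop :=
  exists m : nat, forall i : 'I_3, J ('X_i ^+ m * p).

Definition subscheme (K : closedFieldType) (J1 J2 : {mpoly K[3]} -> Prop) :
    Prop :=
  forall p : {mpoly K[3]}, J2 p -> saturation J1 p.

Definition curve_ideal (K : closedFieldType) (g : {mpoly K[3]}) :
    {mpoly K[3]} -> Prop :=
  ideal_gen (fun _ : 'I_1 => g).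

Definition eigen_minor (K : closedFieldType) (f : {mpoly K[3]})
    (ij : 'I_3 * 'I_3) : {mpoly K[3]} :=
  'X_(ij.1) * f^`M(ij.2) - 'X_(ij.2) * f^`M(ij.1).

Definition eigenscheme (K : closedFieldType) (f : {mpoly K[3]}) :
    {mpoly K[3]} -> Prop :=
  ideal_gen (eigen_minor f).

Definition Qiso (K : closedFieldType) : {mpoly K[3]} :=
  \sum_(i < 3) 'X_i ^+ 2.

(* For r = a x + b y + c z, f(r) = (r^2 - 3 (a^2 + b^2 + c^2) Qiso) r. *)
Definition cubic_of_line (K : closedFieldType) (r : {mpoly K[3]}) :
    {mpoly K[3]} :=
  (r ^+ 2 - (3%:R * \sum_(i < 3) r@_(U_(i)) ^+ 2) *: Qiso K) * r.

(* If the gradient of g at P vanishes, this is false for every line l. *)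
Definition tangent_at (K : closedFieldType) (l g : {mpoly K[3]})
    (P : 'rV[K]_3) : Prop :=
  [/\ P != 0, g.@[P ord0] = 0 &
      same_line l (\sum_(i < 3) g^`M(i).@[P ord0] *: 'X_i)].

Definition tangent_to (K : closedFieldType) (l g : {mpoly K[3]}) : Prop :=
  exists P : 'rV[K]_3, tangent_at l g P.

Definition singular_at (K : closedFieldType) (f : {mpoly K[3]})
    (P : 'rV[K]_3) : Prop :=
  [/\ P != 0, f.@[P ord0] = 0 & forall i : 'I_3, f^`M(i).@[P ord0] = 0].

(* The Taylor expansion f(P + X).  When P = (0,0,1) and
   f = \sum_k f_k(x,y) z^(d-k), one has
   f(P + X) = \sum_k f_k(x,y) (1 + z)^(d-k), so its nonzero homogeneous
   component of least degree is f_m(x,y), with m the multiplicity of V(f) at P: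
   it is the equation, in homogeneous coordinates, of the projective tangent
   cone of V(f) at P. *)
Definition taylor_at (K : closedFieldType) (f : {mpoly K[3]})
    (P : 'rV[K]_3) : {mpoly K[3]} :=
  f \mPo [tuple 'X_i + (P ord0 i)%:MP | i < 3].

Definition mult_at (K : closedFieldType) (f : {mpoly K[3]})
    (P : 'rV[K]_3) : nat :=
  find (fun d => pihomog mdeg d (taylor_at f P) != 0)
       (iota 0 (msize (taylor_at f P))).

Definition tangent_cone (K : closedFieldType) (f : {mpoly K[3]})
    (P : 'rV[K]_3) : {mpoly K[3]} :=
  pihomog mdeg (mult_at f P) (taylor_at f P).

(* An ordinary double point: the tangent cone is a pair of distinct lines. *)
Definition node_at (K : closedFieldType) (f : {mpoly K[3]})
    (P : 'rV[K]_3) : Prop :=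
  [/\ P != 0, mult_at f P = 2%N &
      exists l1 l2 : {mpoly K[3]},
        [/\ is_line l1, is_line l2, ~ same_line l1 l2 &
            tangent_cone f P = l1 * l2]].

Definition nodal (K : closedFieldType) (f : {mpoly K[3]}) : Prop :=
  (exists P : 'rV[K]_3, singular_at f P) /\
  (forall P : 'rV[K]_3, singular_at f P -> node_at f P).

Definition irreducible_form (K : closedFieldType) (f : {mpoly K[3]}) : Prop :=
  [/\ f != 0, f \isn't a GRing.unit &
      forall g h : {mpoly K[3]}, f = g * h ->
        g \is a GRing.unit \/ h \is a GRing.unit].

(* Main.v *)
(* Let [N] be the vector of coefficients of [t].  The line [t] lies in [E(f)] iff
   [t] divides the minors, i.e. iff on the line the gradient of [f] is [g X] with
   [X] the generic point and, by Koszul exactness, [g] a linear form with some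
   coefficient vector [b].  So grad f = g X + t h, Euler's identity gives
   3 f = g Qiso + t H with H = h.X, and differentiating that yields
   g X = Qiso b + H N on the line; pairing with [N],
   (b.N) Qiso + (N.N) H = 0 on the line.
   If N.N <> 0, then Qiso is there a common factor of all the g X_i, which forces
   g = 0; then grad f vanishes on the line and t^2 divides f.
   If N.N = 0, then b.N = 0, so g is on the line a multiple of r0, which is
   also the factor arising from f(r0); subtracting a multiple of f(r0) reduces to
   g = 0.
   At the point of tangency [P], the Taylor expansion of t^2 l + lambda f(r0) is
   t s plus a cubic form, with s = l(P) t - const lambda r0, whence the
   node.  At any other singular point [B], f would vanish identically on the
   line PB, hence be reducible. *)

Require Import Defs.
From mathcomp Require Import all_boot all_order all_algebra.
From mathcomp Require Import reals complex mpoly.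
From mathcomp Require Import ring.

Set Implicit Arguments.
Unset Strict Implicit.
Unset Printing Implicit Defensive.

Import GRing.Theory.
Local Open Scope ring_scope.
Local Open Scope complex_scope.

(** * Cyclic indices and vector algebra in dimension three *)

Lemma ord3_cycle (k i : 'I_3) : [\/ i = k, i = k + 1 | i = k + 1 + 1].
Proof.
have: (i == k) || (i == k + 1) || (i == k + 1 + 1).
  by case: k i => [[|[|[|?]]] ?] [[|[|[|?]]] ?].
case/orP=> [/orP[]|] /eqP ?;
  by [constructor 1|constructor 2|constructor 3].
Qed.

Lemma ord3_add3 (k : 'I_3) : k + 1 + 1 + 1 = k.
Proof. by apply/eqP; case: k => [[|[|[|?]]] ?]. Qed.

Lemma ord3_neq (k : 'I_3) :
  [/\ (k + 1 == k) = false, (k + 1 + 1 == k) = false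
    & (k + 1 + 1 == k + 1) = false].
Proof. by case: k => [[|[|[|?]]] ?]. Qed.

(** Indices are read modulo 3, so any index [k] can serve as the first one; later [k] marks a
    nonzero coordinate. *)
Lemma sum3_cycle (V : nmodType) (k : 'I_3) (F : 'I_3 -> V) :
  \sum_i F i = F k + F (k + 1) + F (k + 1 + 1).
Proof.
have [e1 e2 e3] := ord3_neq k.
rewrite (bigD1 k) //= (bigD1 (k + 1)) ?e1 //=.
rewrite (bigD1 (k + 1 + 1)) ?e2 ?e3 //= big1 ?addr0 ?addrA // => i.
by case: (ord3_cycle k i) => ->; rewrite eqxx ?andbF.
Qed.

Definition dot (A : comNzRingType) (u v : 'I_3 -> A) : A := \sum_i u i * v i.

Definition cross (A : comNzRingType) (u v : 'I_3 -> A) (k : 'I_3) : A :=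
  u (k + 1) * v (k + 1 + 1) - u (k + 1 + 1) * v (k + 1).

Lemma dotC (A : comNzRingType) (u v : 'I_3 -> A) : dot u v = dot v u.
Proof. by apply: eq_bigr => i _; rewrite mulrC. Qed.

(** Cramer's rule with denominators cleared: the hypothesis says that det(a,b,y) vanishes, so y
    depends on a and b. Only the case i = k uses it; for the other indices both sides agree
    identically. *)
Lemma cross_cramer (A : comNzRingType) (a b y : 'I_3 -> A) (k i : 'I_3) :
  dot (cross a b) y = 0 ->
  cross a b k * y i = cross y b k * a i + cross a y k * b i.
Proof.
rewrite /dot (sum3_cycle k) /cross !ord3_add3 => e.
by apply/subr0_eq; case: (ord3_cycle k i) => ->; [rewrite -[RHS]e| |]; ring.
Qed.

(** The difference of the two sides is a combination of n.n, a.n and b.n. Thus, up to n_k^2, the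
    form on the orthogonal of n is a product of one linear factor in a and one in b. *)
Lemma isotropic_dot (A : comNzRingType) (n a b : 'I_3 -> A) (k : 'I_3) :
  dot n n = 0 -> dot a n = 0 -> dot b n = 0 ->
  n k ^+ 2 * dot a b = - (cross a n k * cross b n k).
Proof.
move=> nn an bn; apply/subr0_eq.
have -> : n k ^+ 2 * dot a b - - (cross a n k * cross b n k) =
    (a (k + 1) * b (k + 1) + a (k + 1 + 1) * b (k + 1 + 1)) * dot n n
    + dot a n * (b k * n k)
    - dot b n * (a (k + 1) * n (k + 1) + a (k + 1 + 1) * n (k + 1 + 1)).
  by rewrite /dot !(sum3_cycle k) /cross; ring.
by rewrite nn an bn; ring.
Qed.

(* Orthogonal to an isotropic [n], the form is degenerate of rank one. *)
Lemma isotropic_gram (A : idomainType) (n a b : 'I_3 -> A) (k : 'I_3) :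
  n k != 0 -> dot n n = 0 -> dot a n = 0 -> dot b n = 0 ->
  dot a b ^+ 2 = dot a a * dot b b.
Proof.
move=> nk0 nn an bn; apply: (mulfI (expf_neq0 4 nk0)).
have -> : n k ^+ 4 * dot a b ^+ 2 = (n k ^+ 2 * dot a b) ^+ 2 by ring.
have -> : n k ^+ 4 * (dot a a * dot b b) =
  (n k ^+ 2 * dot a a) * (n k ^+ 2 * dot b b) by ring.
by rewrite !(isotropic_dot k nn) //; ring.
Qed.

(** The double product n x (a x n) = (n.n) a - (a.n) n vanishes, so a x n is parallel to n. *)
Lemma cross_isotropic (A : comNzRingType) (n a : 'I_3 -> A) (i k : 'I_3) :
  dot n n = 0 -> dot a n = 0 -> n k * cross a n i = n i * cross a n k.
Proof.
move=> nn an; apply/subr0_eq.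
have E j : n j * cross a n (j + 1) - n (j + 1) * cross a n j = 0.
  have -> : n j * cross a n (j + 1) - n (j + 1) * cross a n j =
    dot n n * a (j + 1 + 1) - dot a n * n (j + 1 + 1).
    by rewrite /dot !(sum3_cycle j) /cross ord3_add3; ring.
  by rewrite nn an; ring.
case: (ord3_cycle k i) => ->; [by ring | exact: E |].
apply: oppr_inj; rewrite oppr0 -[RHS](E (k + 1 + 1)) ord3_add3; ring.
Qed.

(** * Linear forms, derivatives and homogeneous components *)

Definition mdvd (K : fieldType) (p q : {mpoly K[3]}) : Prop :=
  exists h, q = p * h.

Definition lin (K : fieldType) (a : 'I_3 -> K) : {mpoly K[3]} :=
  \sum_i (a i)%:MP * 'X_i.

Lemma mderivXU (K : fieldType) (i j : 'I_3) :
  ('X_j : {mpoly K[3]})^`M(i) = (j == i)%:R.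
Proof.
rewrite mderivX mnm1E; case: eqP => [->|_]; last by rewrite scale0r.
have -> : (U_(i) - U_(i) = 0 :> 'X_{1.. 3})%MM.
  by rewrite -{1}[U_(i)%MM]add0m addmK.
by rewrite mpolyX0 scale1r.
Qed.

Lemma mderiv_lin (K : fieldType) (a : 'I_3 -> K) i : (lin a)^`M(i) = (a i)%:MP.
Proof.
rewrite /lin raddf_sum (bigD1 i) //= big1 => [|j ji].
  by rewrite mderiv_mulC mderivXU eqxx mulr1 addr0.
by rewrite mderiv_mulC mderivXU (negPf ji) mulr0.
Qed.

Lemma meval_lin (K : fieldType) (a v : 'I_3 -> K) : (lin a).@[v] = dot a v.
Proof.
by rewrite raddf_sum; apply: eq_bigr => i _ /=; rewrite mevalM mevalC mevalXU.
Qed.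

Lemma linear_formE (K : fieldType) (l : {mpoly K[3]}) :
  l \is 1.-homog -> l = lin (fun i => l@_(U_(i))).
Proof.
move=> hl; apply/mpolyP => m; rewrite /lin raddf_sum /=.
under eq_bigr do rewrite mcoeffCM mcoeffX.
have [/mdeg1P[i /eqP ->]|m1] := boolP (mdeg m == 1%N).
  rewrite (bigD1 i) //= eqxx mulr1 big1 ?addr0 // => j ji.
  by rewrite eq_mnm1 (negPf ji) mulr0.
rewrite (dhomog_nemf_coeff hl m1) big1 // => i _.
have /negPf -> : U_(i)%MM != m by apply: contraNneq m1 => <-; rewrite mdeg1.
by rewrite mulr0.
Qed.

Lemma lin_homog (K : fieldType) (a : 'I_3 -> K) : lin a \is 1.-homog.
Proof.
apply: rpred_sum => i _; rewrite mul_mpolyC; apply: rpredZ.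
by rewrite dhomogX; apply/eqP/mdeg1.
Qed.

Lemma mderiv_homog (K : fieldType) (d : nat) (p : {mpoly K[3]}) i :
  p \is d.+1.-homog -> p^`M(i) \is d.-homog.
Proof.
move=> hp; rewrite [p]mpolyE raddf_sum big_seq; apply: rpred_sum => m hm.
rewrite /= mderivZ; apply: rpredZ; rewrite mderivX; have [->|mi0] := eqVneq (m i) 0%N.
  by rewrite scale0r rpred0.
apply: rpredZ; rewrite dhomogX.
have hU : (U_(i) <= m)%MM by rewrite lep1mP.
have := dhomog_mf hp hm => /= hm'; apply/eqP/succn_inj.
by rewrite /= -hm' -{2}(submK hU) mdegD mdeg1 addn1.
Qed.

Lemma euler_homog (K : fieldType) (d : nat) (p : {mpoly K[3]}) :
  p \is d.-homog -> \sum_i 'X_i * p^`M(i) = d%:R * p.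
Proof.
move=> hp; rewrite [in RHS](mpolyE p).
under eq_bigr do rewrite [in X in _ * X](mpolyE p) raddf_sum mulr_sumr.
rewrite exchange_big mulr_sumr !big_seq; apply: eq_bigr => m hm /=.
have /= <- := dhomog_mf hp hm; rewrite mdegE natr_sum mulr_suml; apply: eq_bigr => i _.
rewrite mderivZ mderivX -!scalerAr -!mpolyXD mulr_natl scaler_nat.
have [->|mi0] := eqVneq (m i) 0%N; first by rewrite !mulr0n.
by rewrite addmC submK // lep1mP.
Qed.

Lemma pihomogM (K : fieldType) (d e : nat) (p q : {mpoly K[3]}) :
  p \is d.-homog -> pihomog mdeg (d + e) (p * q) = p * pihomog mdeg e q.
Proof.
(* The bound is enlarged so that [e] indexes a component even when it exceeds the degree of [q]. *)
move=> hp; pose k := maxn (msize q) e.+1.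
have {1}-> := pihomog_partitionE (leq_maxl (msize q) e.+1).
rewrite mulr_sumr raddf_sum /=.
have ek : (e < k)%N by rewrite leq_max ltnSn orbT.
rewrite (bigD1 (Ordinal ek)) //= big1 ?addr0.
  by rewrite pihomog_dE // dhomogM // pihomogP.
move=> i ie; apply: (@pihomog_ne0 _ _ _ (d + i)).
  by rewrite eqn_add2l; apply: contra ie => /eqP ?; apply/eqP/val_inj.
by rewrite dhomogM // pihomogP.
Qed.

Lemma dhomog_factor (K : fieldType) (d e : nat) (p q : {mpoly K[3]}) :
  p != 0 -> p \is d.-homog -> p * q \is (d + e).-homog -> q \is e.-homog.
Proof.
move=> p0 hp hpq; rewrite homog_piE; apply/eqP/(mulfI p0).
by rewrite -(pihomogM _ _ hp) pihomog_dE.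
Qed.

(** * Restriction of polynomials to a line *)

(** An endomorphism with kernel (t) stands for the quotient by t: values on the line stay in the
    same integral domain, where cancellation and degrees are available. *)
Definition line_restr (K : fieldType) (N : 'I_3 -> K) (k : 'I_3)
    (phi : {rmorphism {mpoly K[3]} -> {mpoly K[3]}}) : Prop :=
  [/\ phi (lin N) = 0,
      forall p, mdvd (lin N) (p - phi p),
      forall c : K, phi c%:MP = c%:MP,
      forall d p, p \is d.-homog -> phi p \is d.-homog
    & forall i, i != k -> phi 'X_i = 'X_i].

(* Substituting [X_k := X_k - t / N_k] restricts to the line [t = 0]. *)
Lemma line_restriction (K : fieldType) (N : 'I_3 -> K) (k : 'I_3) :
  N k != 0 ->
  exists phi : {rmorphism {mpoly K[3]} -> {mpoly K[3]}}, line_restr N k phi.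
Proof.
move=> Nk0; pose c i : K := (i == k)%:R / N k.
pose T := [tuple 'X_i - (c i)%:MP * lin N | i < 3].
have TE i : tnth T i = 'X_i - (c i)%:MP * lin N by rewrite tnth_mktuple.
have phiX i : 'X_i \mPo T = 'X_i - (c i)%:MP * lin N.
  by rewrite comp_mpolyXU -tnth_nth TE.
exists (comp_mpoly T : {rmorphism _ -> _}); split.
- rewrite /= [in LHS]/lin raddf_sum /=.
  under eq_bigr do rewrite rmorphM /= comp_mpolyC phiX mulrBr.
  rewrite sumrB -/(lin N) (bigD1 k) //= big1 => [|i ik].
    by rewrite addr0 mulrA -mpolyCM /c eqxx mul1r divff // mul1r subrr.
  by rewrite mulrA -mpolyCM /c (negPf ik) mul0r mulr0 mul0r.
- move=> p /=.
  suff E m : exists q, 'X_[m] = 'X_[m] \mPo T + lin N * q.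
    suff [q hq] : exists q, p = p \mPo T + lin N * q.
      by exists q; rewrite {1}hq addrC addrA addNr add0r.
    elim/mpolyind: p => [|a m p _ _ [q hq]].
      by exists 0; rewrite comp_mpoly0 mulr0 addr0.
    have [q' hq'] := E m; exists (a *: q' + q).
    rewrite {1}hq {1}hq' comp_mpolyD comp_mpolyZ -!mul_mpolyC; ring.
  rewrite mpolyXE_id rmorph_prod /=.
  (* Congruence modulo t; being multiplicative, it passes from the variables to monomials. *)
  pose C (x y : {mpoly K[3]}) := exists q, x = y + lin N * q.
  have CM x y x' y' : C x y -> C x' y' -> C (x * x') (y * y').
    move=> [q ->] [q' ->]; exists (y * q' + q * y' + lin N * q * q'); ring.
  have C1 : C 1 1 by exists 0; rewrite mulr0 addr0.
  apply: (big_ind2 C) => // i _; rewrite rmorphXn /= phiX.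
  elim: (m i) => [|j IH]; first by rewrite !expr0.
  rewrite !exprS; apply: CM => //; exists (c i)%:MP; ring.
- by move=> a /=; rewrite comp_mpolyC.
- move=> d p hp /=; rewrite comp_mpolyE big_seq; apply: rpred_sum => m hm.
  apply: rpredZ; have /= <- := dhomog_mf hp hm; rewrite mdegE.
  elim/big_rec2: _ => [|i e y _ IH]; first exact: dhomog1.
  apply: dhomogM => //; rewrite -{2}[m i]mul1n; apply: dhomogMn.
  rewrite TE mul_mpolyC; apply: rpredB; last by apply/rpredZ/lin_homog.
  by rewrite dhomogX; apply/eqP/mdeg1.
- by move=> i ik /=; rewrite phiX /c (negPf ik) mul0r mpolyC0 mul0r subr0.
Qed.

Lemma restr_dvd (K : fieldType) (N : 'I_3 -> K) k phi p :
  line_restr N k phi -> phi p = 0 <-> mdvd (lin N) p.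
Proof.
case=> phit phiB _ _ _; split=> [p0|[q ->]]; last by rewrite rmorphM phit mul0r.
by have [q] := phiB p; rewrite p0 subr0 => ->; exists q.
Qed.

Lemma restr_id (K : fieldType) (N : 'I_3 -> K) k phi p :
  line_restr N k phi -> phi (phi p) = phi p.
Proof.
move=> rphi; have [_ phiB _ _ _] := rphi.
have /(restr_dvd _ rphi) := phiB p.
by rewrite rmorphB => /subr0_eq.
Qed.

Lemma restr_lin (K : fieldType) (N : 'I_3 -> K) k phi (a : 'I_3 -> K) :
  line_restr N k phi -> phi (lin a) = \sum_i (a i)%:MP * phi 'X_i.
Proof.
case=> _ _ phiC _ _; rewrite rmorph_sum; apply: eq_bigr => i _.
by rewrite rmorphM phiC.
Qed.

Lemma mpolyX_neq0 (K : fieldType) (i : 'I_3) : ('X_i : {mpoly K[3]}) != 0.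
Proof. by rewrite -msize_poly_eq0 msizeX. Qed.

Lemma lin_neq0 (K : fieldType) (N : 'I_3 -> K) :
  lin N != 0 -> exists k, N k != 0.
Proof.
move=> N0; apply/existsP; apply: contraNT N0.
rewrite negb_exists => /forallP N0; rewrite /lin big1 // => i _.
by rewrite (eqP (negbNE (N0 i))) mpolyC0 mul0r.
Qed.

Lemma lin_coef_neq0 (K : fieldType) (N : 'I_3 -> K) k : N k != 0 -> lin N != 0.
Proof.
apply: contraNneq => e; have := mderiv_lin N k.
by rewrite e mderiv0 => /esym/eqP; rewrite mpolyC_eq0.
Qed.

(** The ideal of a line is already saturated: ['X_(k + 1)] restricts to itself on the line, so its
    powers cancel. *)
Lemma curve_subschemeP (K : closedFieldType) (N : 'I_3 -> K) J :
  lin N != 0 ->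
  subscheme (curve_ideal (lin N)) J <-> (forall p, J p -> mdvd (lin N) p).
Proof.
move=> N0; have [k Nk0] := lin_neq0 N0; split=> sub p Jp; last first.
  have [h ph] := sub p Jp; exists 0%N => i.
  by exists (fun _ => h); rewrite big_ord1 expr0 mul1r ph mulrC.
have [phi rphi] := line_restriction Nk0; have [phit _ _ _ phiX] := rphi.
have [m /(_ (k + 1)) [c]] := sub p Jp; rewrite big_ord1.
move/(congr1 phi); rewrite !rmorphM rmorphXn phit mulr0 phiX; last first.
  by have [->] := ord3_neq k.
move/eqP; rewrite mulf_eq0 expf_eq0 (negPf (mpolyX_neq0 K _)) andbF /=.
by move/eqP/(restr_dvd _ rphi).
Qed.

(** Two coordinates of the generic point of the line are coprime variables. The relation between the
    components k+1 and k+2 makes ['X_(k + 1)] divide the restriction of [f (k + 1)]; the quotient is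
    the common factor. *)
Lemma restr_koszul (K : fieldType) (N : 'I_3 -> K) k phi d
    (f : 'I_3 -> {mpoly K[3]}) :
  line_restr N k phi -> (forall i, f i \is d.+1.-homog) ->
  (forall i j, phi 'X_i * phi (f j) = phi 'X_j * phi (f i)) ->
  exists2 g, g \is d.-homog & forall i, phi (f i) = phi g * phi 'X_i.
Proof.
move=> rphi hf H; have [_ _ phiC hphi phiX] := rphi.
have [e1 e2 e3] := ord3_neq k.
have {}phiX1 : phi 'X_(k + 1) = 'X_(k + 1) by rewrite phiX ?e1.
have {}phiX2 : phi 'X_(k + 1 + 1) = 'X_(k + 1 + 1) by rewrite phiX ?e2.
(* [D] is the coefficient vector of the line X_(k+1) = 0; restricting to that line tests
   divisibility by ['X_(k + 1)]. *)
pose D j : K := (j == k + 1)%:R.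
have DX : lin D = 'X_(k + 1).
  rewrite /lin (bigD1 (k + 1)) //= big1 /D => [|j /negPf ->].
    by rewrite eqxx mpolyC1 mul1r addr0.
  by rewrite mpolyC0 mul0r.
have [psi rpsi] : exists psi, line_restr D (k + 1) psi.
  by apply: line_restriction; rewrite /D eqxx oner_neq0.
have [psiD _ _ _ psiX] := rpsi.
have [g hg] : mdvd (lin D) (phi (f (k + 1))).
  apply/(restr_dvd _ rpsi)/(mulfI (mpolyX_neq0 K (k + 1 + 1))).
  rewrite -(psiX (k + 1 + 1)) ?e3 // -rmorphM -phiX2 H phiX1 rmorphM -DX psiD.
  by rewrite mul0r mulr0.
rewrite DX in hg.
have hgH : g \is d.-homog.
  apply: (@dhomog_factor _ 1 d 'X_(k + 1)); first exact: mpolyX_neq0.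
    by rewrite dhomogX; apply/eqP/mdeg1.
  by rewrite -hg; apply: hphi.
exists g => // i.
have -> : phi (f i) = g * phi 'X_i.
  apply: (mulfI (mpolyX_neq0 K (k + 1))).
  by rewrite -{1}phiX1 H hg; ring.
have phig : phi g = g.
  apply: (mulfI (mpolyX_neq0 K (k + 1))).
  by rewrite -{1}phiX1 -rmorphM -hg (restr_id _ rphi).
by rewrite phig.
Qed.

(* Two coordinates stay independent on the line, so a constant vector is not
   proportional to the generic point of the line. *)
Lemma restr_not_proportional (K : fieldType) (N : 'I_3 -> K) k phi
    (a : 'I_3 -> K) (q : {mpoly K[3]}) :
  line_restr N k phi -> q != 0 ->
  (forall i j, (a i)%:MP * q * phi 'X_j = (a j)%:MP * q * phi 'X_i) ->
  forall i, a i = 0.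
Proof.
move=> rphi q0 H; have [_ _ _ _ phiX] := rphi.
have {}H i j : (a i)%:MP * phi 'X_j = (a j)%:MP * phi 'X_i.
  by apply: (mulfI q0); rewrite mulrCA mulrA H; ring.
have [e1 e2 e3] := ord3_neq k.
have {}phiX1 : phi 'X_(k + 1) = 'X_(k + 1) by rewrite phiX ?e1.
have {}phiX2 : phi 'X_(k + 1 + 1) = 'X_(k + 1 + 1) by rewrite phiX ?e2.
have := H (k + 1) (k + 1 + 1); rewrite phiX1 phiX2 => E.
have a1 : a (k + 1) = 0.
  have := congr1 (mcoeff U_(k + 1 + 1)) E; rewrite !mcoeffCM !mcoeffXU eqxx.
  by rewrite eq_sym e3 mulr1 mulr0.
have a2 : a (k + 1 + 1) = 0.
  have := congr1 (mcoeff U_(k + 1)) E; rewrite !mcoeffCM !mcoeffXU eqxx.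
  by rewrite e3 mulr1 mulr0.
have a0 : a k = 0.
  have := H k (k + 1); rewrite phiX1 a1 mpolyC0 mul0r => /eqP.
  by rewrite mulf_eq0 (negPf (mpolyX_neq0 K _)) orbF mpolyC_eq0 => /eqP.
by move=> i; case: (ord3_cycle k i) => ->.
Qed.

(** * The gradient along a line contained in the eigenscheme *)

Lemma mderiv_Qiso (K : closedFieldType) i :
  (Qiso K)^`M(i) = 2%:R * 'X_i.
Proof.
rewrite /Qiso raddf_sum (bigD1 i) //= big1 => [|j /negPf ji].
  by rewrite expr2 mderivM mderivXU eqxx mulr1 mul1r mulr_natl mulr2n addr0.
by rewrite expr2 mderivM mderivXU ji mulr0 mul0r addr0.
Qed.

Lemma mpoly_natr_neq0 (K : fieldType) n :
  n%:R != 0 :> K -> n%:R != 0 :> {mpoly K[3]}.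
Proof. by rewrite -(rmorph_nat (@mpolyC 3 K)) mpolyC_eq0. Qed.

(** If Qiso = t h, differentiating gives 2 X = h N on the line, so the generic point would be
    proportional to the constant vector N. *)
Lemma restr_Qiso_neq0 (K : closedFieldType) (N : 'I_3 -> K) k phi :
  2%:R != 0 :> K -> N k != 0 -> line_restr N k phi -> phi (Qiso K) != 0.
Proof.
move=> h2 Nk0 rphi; have [phit _ phiC _ phiX] := rphi.
apply/eqP => /(restr_dvd _ rphi) [h hQ].
have E i : 2%:R * phi 'X_i = (N i)%:MP * phi h.
  have := congr1 (mderiv i) hQ; rewrite mderiv_Qiso mderivM mderiv_lin.
  move/(congr1 phi); rewrite rmorphD !rmorphM phit phiC rmorph_nat => ->. ring.
have [h0|h0] := eqVneq (phi h) 0; last first.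
  have N0 : forall i, N i = 0.
    apply: (restr_not_proportional rphi h0) => i j; rewrite -!E; ring.
  by rewrite N0 eqxx in Nk0.
have := E (k + 1); rewrite h0 mulr0 phiX; last by have [->] := ord3_neq k.
move/eqP; rewrite mulf_eq0 (negPf (mpolyX_neq0 K _)) orbF.
by rewrite (negPf (mpoly_natr_neq0 h2)).
Qed.

(** Euler's identity gives f = t h; then the derivative in direction k restricts to N_k h, which
    forces t to divide h as well. *)
Lemma double_line (K : fieldType) (N : 'I_3 -> K) k (f : {mpoly K[3]}) :
  3%:R != 0 :> K -> N k != 0 -> f \is 3.-homog ->
  (forall i, mdvd (lin N) f^`M(i)) ->
  exists2 l, l \is 1.-homog & f = lin N ^+ 2 * l.
Proof.
move=> h3 Nk0 hf dvd.
have [phi rphi] := line_restriction Nk0; have [phit _ phiC _ _] := rphi.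
have {dvd} dvd i : phi f^`M(i) = 0 by apply/(restr_dvd _ rphi).
have f0 : phi f = 0.
  apply: (mulfI (mpoly_natr_neq0 h3)).
  rewrite -{1}(rmorph_nat phi) -rmorphM -(euler_homog hf) rmorph_sum mulr0.
  by rewrite big1 // => i _; rewrite rmorphM dvd mulr0.
have [h fh] : mdvd (lin N) f by apply/(restr_dvd _ rphi).
have h0 : phi h = 0.
  have := dvd k; rewrite fh mderivM mderiv_lin rmorphD !rmorphM phit phiC mul0r.
  by rewrite addr0 => /eqP; rewrite mulf_eq0 mpolyC_eq0 (negPf Nk0) => /eqP.
have [l hl] : mdvd (lin N) h by apply/(restr_dvd _ rphi).
have fE : f = lin N ^+ 2 * l by rewrite fh hl; ring.
exists l => //; apply: (@dhomog_factor _ 2 1 (lin N ^+ 2)).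
- by rewrite expf_neq0 // (lin_coef_neq0 Nk0).
- exact: (dhomogMn 2 (lin_homog N)).
- by rewrite -fE.
Qed.

(* Koszul exactness makes the gradient of [f] proportional to the generic point
   of the line, with a linear factor; differentiating Euler's identity then
   constrains that factor. *)
Lemma eigen_line_factor (K : closedFieldType) (N : 'I_3 -> K) k phi
    (f : {mpoly K[3]}) :
  2%:R != 0 :> K -> N k != 0 -> line_restr N k phi -> f \is 3.-homog ->
  (forall i j, mdvd (lin N) (eigen_minor f (i, j))) ->
  exists b : 'I_3 -> K,
    [/\ forall i, phi f^`M(i) = phi (lin b) * phi 'X_i,
        dot N N != 0 -> phi (lin b) = 0
      & dot N N = 0 -> dot b N = 0].
Proof.
move=> h2 Nk0 rphi hf dvd; have [phit phiB phiC _ phiX] := rphi.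
have [g hg phif] : exists2 g, g \is 1.-homog &
    forall i, phi f^`M(i) = phi g * phi 'X_i.
  apply: (restr_koszul rphi) => [i|i j]; first exact: mderiv_homog.
  have /(restr_dvd _ rphi) := dvd i j.
  by rewrite rmorphB !rmorphM => /subr0_eq.
rewrite (linear_formE hg) in phif; move: (fun i => _) phif => b {g hg} phif.
have /fin_all_exists [h fh] i : exists h, f^`M(i) = lin b * 'X_i + lin N * h.
  have [|h hh] := (restr_dvd (f^`M(i) - lin b * 'X_i) rphi).1.
    by rewrite rmorphB rmorphM phif subrr.
  by exists h; rewrite -hh addrC subrK.
pose H := \sum_i 'X_i * h i.
have fE : 3%:R * f = lin b * Qiso K + lin N * H.
  rewrite -(euler_homog hf) /Qiso /H !mulr_sumr -big_split; apply: eq_bigr => i _.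
  by rewrite fh /=; ring.
(* Differentiating [fE] on the line gives 3 g X_i = b_i Qiso + 2 g X_i + N_i H, with g = [lin b]. *)
have E i : phi (lin b) * phi 'X_i = (b i)%:MP * phi (Qiso K) + (N i)%:MP * phi H.
  have := congr1 (mderiv i) fE.
  rewrite -(rmorph_nat (@mpolyC 3 K)) mderiv_mulC mderivD !mderivM !mderiv_lin.
  rewrite mderiv_Qiso => /(congr1 phi).
  rewrite !(rmorph_nat, rmorphD, rmorphM) phit !phiC phif => E3.
  apply/subr0_eq; move/eqP: E3; rewrite -subr_eq0 => /eqP <-; ring.
have NE : (dot b N)%:MP * phi (Qiso K) + (dot N N)%:MP * phi H = 0.
  have -> : 0 = phi (lin b) * phi (lin N) by rewrite phit mulr0.
  rewrite (restr_lin N rphi) mulr_sumr /dot !(rmorph_sum (@mpolyC 3 K)) !mulr_suml -big_split /=.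
  by apply: eq_bigr => i _; rewrite [RHS]mulrCA E !mpolyCM /=; ring.
have Q0 := restr_Qiso_neq0 h2 Nk0 rphi.
exists b; split=> // NN; last first.
  move/eqP: NE; rewrite NN mpolyC0 mul0r addr0 mulf_eq0 (negPf Q0) orbF.
  by rewrite mpolyC_eq0 => /eqP.
(* Eliminating [phi H] between [E] and [NE] leaves the constant vector [a] times Qiso, proportional
   to the generic point; hence [a] is zero. *)
pose a i := dot N N * b i - N i * dot b N.
have aE i : (a i)%:MP * phi (Qiso K) = (dot N N)%:MP * phi (lin b) * phi 'X_i.
  rewrite -mulrA E; apply/subr0_eq; rewrite -[RHS](mulr0 (- (N i)%:MP)) -NE.
  by rewrite /a mpolyCB !mpolyCM; ring.
have a0 : forall i, a i = 0.
  by apply: (restr_not_proportional rphi Q0) => i j; rewrite !aE; ring.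
have := aE (k + 1); rewrite a0 mpolyC0 mul0r phiX; last by have [->] := ord3_neq k.
move/esym/eqP; rewrite !mulf_eq0 mpolyC_eq0 (negPf NN) (negPf (mpolyX_neq0 K _)).
by rewrite orbF => /eqP.
Qed.

(** * Coefficient vectors of lines and tangency to the conic *)

Lemma mcoeff_lin (K : fieldType) (a : 'I_3 -> K) i : (lin a)@_(U_(i)) = a i.
Proof.
rewrite /lin raddf_sum (bigD1 i) //= big1 => [|j /negPf ji].
  by rewrite mcoeffCM mcoeffXU eqxx mulr1 addr0.
by rewrite mcoeffCM mcoeffXU ji mulr0.
Qed.

Lemma lineP (K : closedFieldType) (l : {mpoly K[3]}) :
  is_line l -> exists2 a, l = lin a & exists k, a k != 0.
Proof.
case=> hl l0; exists (fun i => l@_(U_(i))); first exact: linear_formE.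
by apply: lin_neq0; rewrite -linear_formE.
Qed.

Lemma same_line_lin (K : closedFieldType) (a b : 'I_3 -> K) (c : K) :
  c != 0 -> (forall i, a i = c * b i) -> same_line (lin a) (lin b).
Proof.
move=> c0 ab; exists c => //; rewrite /lin scaler_sumr.
by apply: eq_bigr => i _; rewrite ab mpolyCM -mul_mpolyC mulrA.
Qed.

Lemma meval_Qiso (K : closedFieldType) (v : 'I_3 -> K) : (Qiso K).@[v] = dot v v.
Proof.
rewrite raddf_sum; apply: eq_bigr => i _ /=.
by rewrite rmorphXn /= mevalXU expr2.
Qed.

(** The gradient of Qiso at P is 2 P, so the polar line of P has coefficient vector proportional to
    P. *)
Lemma tangent_at_QisoP (K : closedFieldType) (N : 'I_3 -> K) (P : 'rV[K]_3) :
  2%:R != 0 :> K ->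
  tangent_at (lin N) (Qiso K) P <->
  [/\ P != 0, dot (P ord0) (P ord0) = 0
    & exists2 c, c != 0 & forall i, N i = c * P ord0 i].
Proof.
move=> h2; rewrite /tangent_at meval_Qiso.
have -> : \sum_(i < 3) (Qiso K)^`M(i).@[P ord0] *: 'X_i =
    lin (fun i => 2%:R * P ord0 i) :> {mpoly K[3]}.
  apply: eq_bigr => i _.
  by rewrite mderiv_Qiso mevalM mevalXU rmorph_nat mul_mpolyC.
split=> [[P0 PP [c c0 e]]|[P0 PP [c c0 e]]]; split=> //.
  exists (c * 2%:R) => [|i]; first by rewrite mulf_neq0.
  by rewrite -mcoeff_lin e mcoeffZ mcoeff_lin mulrA.
apply: (@same_line_lin _ _ _ (c / 2%:R)) => [|i].
  by rewrite mulf_neq0 ?invr_eq0.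
by rewrite e mulrA divfK.
Qed.

(** An isotropic N is, as a point, its own point of tangency. *)
Lemma tangent_to_Qiso (K : closedFieldType) (N : 'I_3 -> K) :
  2%:R != 0 :> K -> lin N != 0 -> dot N N = 0 -> tangent_to (lin N) (Qiso K).
Proof.
move=> h2 /lin_neq0 [k Nk0] NN; exists (\row_i N i).
apply/(tangent_at_QisoP _ _ h2); split.
- by apply: contraNneq Nk0 => /rowP /(_ k); rewrite !mxE => ->.
- by rewrite -[RHS]NN; apply: eq_bigr => i _; rewrite !mxE.
- by exists 1 => [|i]; rewrite ?oner_eq0 // mul1r mxE.
Qed.

Lemma eigenscheme_lineP (K : closedFieldType) (N : 'I_3 -> K) f :
  lin N != 0 ->
  subscheme (curve_ideal (lin N)) (eigenscheme f) <->
  (forall i j, mdvd (lin N) (eigen_minor f (i, j))).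
Proof.
move=> N0; apply: (iff_trans (curve_subschemeP _ N0)); split=> dvd.
  move=> i j; apply: dvd; exists (fun ij => (ij == (i, j))%:R).
  rewrite (bigD1 (i, j)) //= eqxx mul1r big1 ?addr0 // => ij /negPf ->.
  by rewrite mul0r.
move=> p [c ->].
have /fin_all_exists [h hh] : forall ij, exists h, eigen_minor f ij = lin N * h.
  by case=> i j; apply: dvd.
exists (\sum_ij c ij * h ij); rewrite mulr_sumr; apply: eq_bigr => ij _.
by rewrite hh mulrCA.
Qed.

(** * The cubic f(r) and the plane orthogonal to an isotropic vector *)

Lemma cubic_of_linE (K : closedFieldType) (M : 'I_3 -> K) :
  cubic_of_line (lin M) =
  (lin M ^+ 2 - 3%:R * (dot M M)%:MP * Qiso K) * lin M.
Proof.
rewrite /cubic_of_line -mul_mpolyC mpolyCM rmorph_nat; congr ((_ - _ * _ * _) * _).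
by congr _%:MP; apply: eq_bigr => i _; rewrite mcoeff_lin expr2.
Qed.

Lemma mderiv_cubic_of_lin (K : closedFieldType) (M : 'I_3 -> K) i :
  (cubic_of_line (lin M))^`M(i) =
  3%:R * (lin M ^+ 2 - (dot M M)%:MP * Qiso K) * (M i)%:MP
  - 6%:R * (dot M M)%:MP * lin M * 'X_i.
Proof.
rewrite cubic_of_linE -(rmorph_nat (@mpolyC 3 K)) -mpolyCM.
rewrite mderivM mderivB mderiv_mulC expr2 mderivM mderiv_lin mderiv_Qiso.
by rewrite mpolyCM rmorph_nat; ring.
Qed.

Lemma cubic_of_line_homog (K : closedFieldType) (M : 'I_3 -> K) :
  cubic_of_line (lin M) \is 3.-homog.
Proof.
rewrite /cubic_of_line; apply: (@dhomogM _ _ _ 2 _ 1); last exact: lin_homog.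
apply: rpredB; first exact: (dhomogMn 2 (lin_homog M)).
apply/rpredZ/rpred_sum => i _; apply: (@dhomogMn _ _ _ 1 _ 2).
by rewrite dhomogX; apply/eqP/mdeg1.
Qed.

Lemma cross_eq0 (K : fieldType) (u v : 'I_3 -> K) k :
  v k != 0 -> (forall i, cross u v i = 0) -> forall i, u i = u k / v k * v i.
Proof.
move=> vk0 c0 i; apply: (mulfI vk0); apply/subr0_eq.
have -> : v k * u i - v k * (u k / v k * v i) = v k * u i - u k * v i.
  by congr (_ - _); rewrite mulrA mulrCA divff // mulr1.
case: (ord3_cycle k i) => ->.
- by rewrite mulrC subrr.
- have := c0 (k + 1 + 1); rewrite /cross ord3_add3 => e.
  apply: oppr_inj; rewrite oppr0 -[RHS]e; ring.
- have := c0 (k + 1); rewrite /cross ord3_add3 => e.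
  rewrite -[RHS]e; ring.
Qed.

(** M x N is parallel to N and N_k is nonzero, so a zero k-th component would make the whole product
    vanish. *)
Lemma isotropic_cross_neq0 (K : fieldType) (N M : 'I_3 -> K) k :
  N k != 0 -> dot N N = 0 -> dot M N = 0 ->
  ~ (exists c, forall i, M i = c * N i) -> cross M N k != 0.
Proof.
move=> Nk0 NN MN ind; apply/eqP => ck0; apply: ind.
exists (M k / N k); apply: (cross_eq0 (Nk0)) => i; apply: (mulfI Nk0).
by rewrite cross_isotropic // ck0 !mulr0.
Qed.

Lemma isotropic_norm_neq0 (K : fieldType) (N M : 'I_3 -> K) k :
  N k != 0 -> dot N N = 0 -> dot M N = 0 ->
  ~ (exists c, forall i, M i = c * N i) -> dot M M != 0.
Proof.
move=> Nk0 NN MN ind; apply/eqP => MM.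
have := isotropic_dot k NN MN MN; rewrite MM mulr0 => /esym/eqP.
rewrite oppr_eq0 mulf_eq0 orbb; apply/negP.
exact: isotropic_cross_neq0.
Qed.

(** M and N span the plane orthogonal to N: since M x N is parallel to N, b.N = 0 says that
    det(M,N,b) = 0, and Cramer's rule gives the coefficients. *)
Lemma isotropic_orthogonal (K : fieldType) (N M b : 'I_3 -> K) :
  (exists k, N k != 0) -> dot N N = 0 -> dot M N = 0 -> dot b N = 0 ->
  ~ (exists c, forall i, M i = c * N i) ->
  exists x y, forall i, b i = x * M i + y * N i.
Proof.
move=> [k Nk0] NN MN bN ind.
have ck0 := isotropic_cross_neq0 Nk0 NN MN ind.
exists (cross b N k / cross M N k), (cross M b k / cross M N k) => i.
apply: (mulfI ck0); rewrite cross_cramer; first by field.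
apply: (mulfI Nk0); rewrite mulr0 /dot mulr_sumr.
under eq_bigr do rewrite mulrA cross_isotropic // mulrAC mulrC [N _ * _]mulrC.
by rewrite -mulr_sumr -/(dot b N) bN mulr0.
Qed.

(* The radical of the form on the tangent line is the point of tangency, so
   [Qiso] restricts there to a multiple of the square of [lin M]. *)
Lemma restr_cubic_of_line (K : closedFieldType) (N M : 'I_3 -> K) k phi i :
  N k != 0 -> line_restr N k phi -> dot N N = 0 -> dot M N = 0 ->
  phi (cubic_of_line (lin M))^`M(i) =
  (- (6%:R * dot M M))%:MP * phi (lin M) * phi 'X_i.
Proof.
move=> Nk0 rphi NN MN; have [phit _ phiC _ _] := rphi.
rewrite mderiv_cubic_of_lin !(rmorphB, rmorph_nat, rmorphXn, rmorphM) /=.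
suff -> : phi (lin M) ^+ 2 = phi (dot M M)%:MP * phi (Qiso K).
  by rewrite !phiC mpolyCN mpolyCM rmorph_nat; ring.
have CE (u v : 'I_3 -> K) :
    dot (fun i => (u i)%:MP : {mpoly K[3]}) (fun i => (v i)%:MP) = (dot u v)%:MP.
  by rewrite /dot (rmorph_sum (@mpolyC 3 K)); apply: eq_bigr => j _ /=; rewrite mpolyCM.
have XE (u : 'I_3 -> K) :
    dot (fun i => (u i)%:MP) (fun i => phi 'X_i) = phi (lin u).
  by rewrite (restr_lin u rphi).
rewrite phiC -CE -XE.
have -> : phi (Qiso K) = dot (fun i => phi 'X_i) (fun i => phi 'X_i).
  by rewrite rmorph_sum; apply: eq_bigr => j _; rewrite rmorphXn expr2.
(* The rank-one identity is used over the polynomial ring, for M and the generic point of the line,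
   which is orthogonal to N because t restricts to zero. *)
apply: (@isotropic_gram _ (fun i => (N i)%:MP) _ _ k).
- by rewrite mpolyC_eq0.
- by rewrite CE NN mpolyC0.
- by rewrite CE MN mpolyC0.
- by rewrite dotC XE.
Qed.

Lemma mdvd_minor_double_line (K : fieldType) (t l : {mpoly K[3]}) i :
  mdvd t (t ^+ 2 * l)^`M(i).
Proof.
exists (2%:R * t^`M(i) * l + t * l^`M(i)).
by rewrite mderivM expr2 mderivM; ring.
Qed.

(** On the line t^2 l contributes nothing to the gradient, and the gradient of f(r) is proportional
    to the generic point. The disjunction serves the non-tangent and the tangent case together. *)
Lemma eigen_minor_combination (K : closedFieldType) (N M : 'I_3 -> K) l
    (lambda : K) i j :
  (exists k, N k != 0) -> (lambda = 0 \/ dot N N = 0 /\ dot M N = 0) ->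
  mdvd (lin N)
    (eigen_minor (lin N ^+ 2 * l + lambda *: cubic_of_line (lin M)) (i, j)).
Proof.
move=> [k Nk0] H; have [phi rphi] := line_restriction Nk0.
have [_ _ phiC _ _] := rphi.
apply/(restr_dvd _ rphi); rewrite /eigen_minor /= rmorphB !rmorphM.
have dE m : phi (lin N ^+ 2 * l + lambda *: cubic_of_line (lin M))^`M(m) =
    lambda%:MP * phi (cubic_of_line (lin M))^`M(m).
  have /(restr_dvd _ rphi) d0 := mdvd_minor_double_line (lin N) l m.
  by rewrite mderivD mderivZ rmorphD d0 add0r -mul_mpolyC rmorphM phiC.
rewrite !dE; case: H => [->|[NN MN]]; first by rewrite mpolyC0; ring.
by rewrite !(restr_cubic_of_line _ Nk0 rphi NN MN); ring.
Qed.

(** * The two containment criteria *)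

Lemma eigen_nontangent (K : closedFieldType) (N : 'I_3 -> K) f :
  2%:R != 0 :> K -> 3%:R != 0 :> K -> lin N != 0 -> dot N N != 0 ->
  f \is 3.-homog ->
  subscheme (curve_ideal (lin N)) (eigenscheme f) <->
  exists l, linear_form l /\ f = lin N ^+ 2 * l.
Proof.
move=> h2 h3 N0 NN hf; apply: (iff_trans (eigenscheme_lineP _ N0)).
have [k Nk0] := lin_neq0 N0; split=> [dvd|[l [_ ->]] i j]; last first.
  have := @eigen_minor_combination K N N l 0 i j.
  by rewrite scale0r addr0; apply; [exists k | left].
have [phi rphi] := line_restriction Nk0.
have [b [fb b0 _]] := eigen_line_factor h2 Nk0 rphi hf dvd.
have [i|l hl fl] := double_line h3 Nk0 hf; last by exists l.
by apply/(restr_dvd _ rphi); rewrite fb b0 // mul0r.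
Qed.

Lemma eigen_tangent (K : closedFieldType) (N M : 'I_3 -> K) f :
  2%:R != 0 :> K -> 3%:R != 0 :> K -> lin N != 0 ->
  dot N N = 0 -> dot M N = 0 -> ~ (exists c, forall i, M i = c * N i) ->
  f \is 3.-homog ->
  subscheme (curve_ideal (lin N)) (eigenscheme f) <->
  exists l (lambda : K),
    linear_form l /\ f = lin N ^+ 2 * l + lambda *: cubic_of_line (lin M).
Proof.
move=> h2 h3 N0 NN MN ind hf; apply: (iff_trans (eigenscheme_lineP _ N0)).
have exk := lin_neq0 N0; have [k Nk0] := exk.
split=> [dvd|[l [la [_ ->]]] i j]; last by apply: eigen_minor_combination; auto.
have [phi rphi] := line_restriction Nk0; have [phit _ phiC _ _] := rphi.
have [b [fb _ bN]] := eigen_line_factor h2 Nk0 rphi hf dvd.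
have [x [y bE]] := isotropic_orthogonal exk NN MN (bN NN) ind.
have MM := isotropic_norm_neq0 Nk0 NN MN ind.
have phib : phi (lin b) = x%:MP * phi (lin M).
  have -> : lin b = x%:MP * lin M + y%:MP * lin N.
    rewrite /lin !mulr_sumr -big_split; apply: eq_bigr => i _ /=.
    by rewrite bE mpolyCD !mpolyCM; ring.
  by rewrite rmorphD !rmorphM phit !phiC mulr0 addr0.
have h6 : 6%:R != 0 :> K by rewrite (natrM _ 2 3) mulf_neq0.
(* On the line the gradient of f(r) is -6 (M.M) r X and that of f is x r X; this [la] makes them
   cancel. *)
pose la := - (x / (6%:R * dot M M)).
have laE : la * - (6%:R * dot M M) = x by rewrite mulrNN divfK // mulf_neq0.
have [| i |l hl fl] :=
    @double_line _ N k (f - la *: cubic_of_line (lin M)) h3 Nk0.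
- by apply: rpredB => //; apply/rpredZ/cubic_of_line_homog.
- apply/(restr_dvd _ rphi); rewrite mderivB mderivZ -mul_mpolyC rmorphB rmorphM.
  rewrite phiC fb phib (restr_cubic_of_line _ Nk0 rphi NN MN) -laE mpolyCM; ring.
- by exists l, la; split=> //; rewrite -fl subrK.
Qed.

(** * Reducibility, tangent cones and the node at P *)

Lemma homog_notunit (K : fieldType) d (p : {mpoly K[3]}) :
  p \is d.+1.-homog -> p \isn't a GRing.unit.
Proof.
move=> hp; apply/negP => /andP[_]; rewrite (dhomog_nemf_coeff hp) ?unitr0 //.
by rewrite /= mdeg0.
Qed.

Lemma irreducible_no_factor (K : closedFieldType) d e (p q : {mpoly K[3]}) :
  irreducible_form (p * q) -> p \is d.+1.-homog -> p * q \is (d.+1 + e.+1).-homog ->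
  False.
Proof.
case=> pq0 _ irr hp hpq; have p0 : p != 0 by apply: contraNneq pq0 => ->; rewrite mul0r.
have hq := dhomog_factor p0 hp hpq.
by have [] := irr p q erefl; apply/negP; [have := homog_notunit hp|have := homog_notunit hq].
Qed.

Lemma cone_of_expansion (K : closedFieldType) (f p q : {mpoly K[3]}) P :
  taylor_at f P = p + q -> p != 0 -> p \is 2.-homog -> q \is 3.-homog ->
  mult_at f P = 2%N /\ tangent_cone f P = p.
Proof.
move=> fE p0 hp hq.
have T0 d : d != 2%N -> d != 3%N -> pihomog mdeg d (taylor_at f P) = 0.
  rewrite eq_sym => d2; rewrite eq_sym => d3.
  by rewrite fE raddfD /= (pihomog_ne0 d2 hp) (pihomog_ne0 d3 hq) addr0.
have T2 : pihomog mdeg 2 (taylor_at f P) = p.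
  by rewrite fE raddfD /= pihomog_dE // (@pihomog_ne0 _ _ mdeg 3 2 q) ?addr0.
(* [mult_at] searches only degrees below [msize], so degree 2 must be shown to lie in that range. *)
have sz : (2 < msize (taylor_at f P))%N.
  rewrite ltnNge; apply/negP => sz; move/negP: p0; apply; rewrite -T2.
  rewrite pihomogE big_seq_cond big1 // => m /andP[hm /eqP /= m2].
  by have := leq_trans (msize_mdeg_lt hm) sz; rewrite m2.
suff mE : mult_at f P = 2%N by rewrite /tangent_cone mE.
rewrite /mult_at; case: (msize _) sz => [|[|[|n]]] //= _.
by rewrite (T0 0%N) // (T0 1%N) // eqxx T2 p0.
Qed.

Lemma taylor_lin (K : closedFieldType) (a : 'I_3 -> K) (P : 'rV[K]_3) :
  taylor_at (lin a) P = lin a + (dot a (P ord0))%:MP.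
Proof.
rewrite /taylor_at {1}/lin rmorph_sum /lin /dot (rmorph_sum (@mpolyC 3 K)).
rewrite -big_split; apply: eq_bigr => i _ /=.
by rewrite rmorphM /= comp_mpolyC comp_mpolyXU -tnth_nth tnth_mktuple mpolyCM mulrDr.
Qed.

Lemma taylor_Qiso (K : closedFieldType) (P : 'rV[K]_3) :
  taylor_at (Qiso K) P =
  Qiso K + 2%:R * lin (P ord0) + (dot (P ord0) (P ord0))%:MP.
Proof.
rewrite /taylor_at {1}/Qiso rmorph_sum /lin /dot (rmorph_sum (@mpolyC 3 K)).
rewrite mulr_sumr /Qiso -!big_split; apply: eq_bigr => i _ /=.
by rewrite rmorphXn /= comp_mpolyXU -tnth_nth tnth_mktuple mpolyCM; ring.
Qed.

(** Translation by P fixes t and r and adds to Qiso only 2 t / c. So t^2 l contributes l(P) t^2 and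
    f(r) a multiple of t r, and the cubic part is f again. *)
Lemma taylor_combination (K : closedFieldType) (N M a : 'I_3 -> K)
    (P : 'rV[K]_3) (c lambda : K) :
  c != 0 -> (forall i, N i = c * P ord0 i) -> dot (P ord0) (P ord0) = 0 ->
  dot M (P ord0) = 0 ->
  let f := lin N ^+ 2 * lin a + lambda *: cubic_of_line (lin M) in
  taylor_at f P = lin N *
    lin (fun i => dot a (P ord0) * N i - 6%:R * lambda * dot M M / c * M i) + f.
Proof.
move=> c0 NP PP MP f.
have NdP : dot N (P ord0) = 0.
  by rewrite -[RHS](mulr0 c) -PP mulr_sumr; apply: eq_bigr => i _; rewrite NP mulrA.
have PE : lin (P ord0) = c^-1%:MP * lin N.
  rewrite /lin mulr_sumr; apply: eq_bigr => i _.
  by rewrite NP mulrA -mpolyCM mulKf.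
have -> : lin (fun i => dot a (P ord0) * N i - 6%:R * lambda * dot M M / c * M i) =
    (dot a (P ord0))%:MP * lin N
    - 6%:R * lambda%:MP * (dot M M)%:MP * c^-1%:MP * lin M.
  move: (dot a (P ord0)) (dot M M) => x1 x2.
  rewrite /lin !mulr_sumr -sumrB; apply: eq_bigr => i _.
  by rewrite mpolyCB !mpolyCM rmorph_nat; ring.
have TM p q : taylor_at (p * q) P = taylor_at p P * taylor_at q P by exact: rmorphM.
have TD p q : taylor_at (p + q) P = taylor_at p P + taylor_at q P by exact: rmorphD.
have TN p : taylor_at (- p) P = - taylor_at p P by exact: rmorphN.
have TC x : taylor_at x%:MP P = x%:MP by exact: comp_mpolyC.
rewrite /f -mul_mpolyC cubic_of_linE -(rmorph_nat (@mpolyC 3 K)) !expr2.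
rewrite !(TM, TD, TN, TC) !taylor_lin taylor_Qiso NdP MP PP PE mpolyC0 rmorph_nat.
by ring.
Qed.

Lemma combination_homog (K : closedFieldType) (N M a : 'I_3 -> K) (lambda : K) :
  lin N ^+ 2 * lin a + lambda *: cubic_of_line (lin M) \is 3.-homog.
Proof.
apply: rpredD; last by apply/rpredZ/cubic_of_line_homog.
exact: dhomogM (dhomogMn 2 (lin_homog N)) (lin_homog a).
Qed.

Lemma node_combination (K : closedFieldType) (N M a : 'I_3 -> K)
    (P : 'rV[K]_3) (c lambda : K) :
  6%:R != 0 :> K -> P != 0 -> c != 0 -> (forall i, N i = c * P ord0 i) ->
  dot (P ord0) (P ord0) = 0 -> dot M (P ord0) = 0 -> dot M M != 0 ->
  ~ (exists c, forall i, M i = c * N i) -> lambda != 0 ->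
  let f := lin N ^+ 2 * lin a + lambda *: cubic_of_line (lin M) in
  node_at f P /\ mdvd (lin N) (tangent_cone f P).
Proof.
move=> h6 P0 c0 NP PP MP MM ind la0 f.
have [k Pk0] : exists k, P ord0 k != 0.
  apply/existsP; apply: contraNT P0; rewrite negb_exists => /forallP e.
  by apply/eqP/rowP => i; rewrite mxE; apply/eqP; have := e i; rewrite negbK.
have N0 : lin N != 0 by apply: (@lin_coef_neq0 _ _ k); rewrite NP mulf_neq0.
have := taylor_combination a lambda c0 NP PP MP; rewrite -/f.
set s := fun i => _ => fE.
have e0 : 6%:R * lambda * dot M M / c != 0 by rewrite !mulf_neq0 ?invr_eq0.
(* The coefficient of M in [s] is nonzero, so a relation s = x N would make M a multiple of N. *)
have ind_s x : ~ (forall i, s i = x * N i).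
  move=> sN; apply: ind.
  exists ((dot a (P ord0) - x) / (6%:R * lambda * dot M M / c)) => i.
  apply: (mulfI e0); rewrite mulrA [_ * (_ / _)]mulrCA divff // mulr1 mulrBl.
  by rewrite -sN /s opprB addrCA subrr addr0.
have s0 : lin s != 0.
  apply/eqP => s0; apply: (ind_s 0) => i.
  by rewrite -[s i]mcoeff_lin s0 mcoeff0 mul0r.
have [||| mE coneE] := cone_of_expansion fE.
- by rewrite mulf_neq0.
- exact: dhomogM (lin_homog N) (lin_homog s).
- exact: combination_homog.
split; last by exists (lin s).
split=> //; exists (lin N), (lin s); split=> //.
- by split=> //; apply: lin_homog.
- by split=> //; apply: lin_homog.
- case=> x x0 NE; apply: (ind_s x^-1) => i.
  by rewrite -[N i]mcoeff_lin NE mcoeffZ mulKf // mcoeff_lin.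
Qed.

(** * Excluding further singular points *)

Lemma mderiv_combination (K : closedFieldType) (N M a : 'I_3 -> K) (lambda : K) i :
  (lin N ^+ 2 * lin a + lambda *: cubic_of_line (lin M))^`M(i) =
  2%:R * lin N * lin a * (N i)%:MP + lin N ^+ 2 * (a i)%:MP + lambda%:MP *
    (3%:R * (lin M ^+ 2 - (dot M M)%:MP * Qiso K) * (M i)%:MP
     - 6%:R * (dot M M)%:MP * lin M * 'X_i).
Proof.
rewrite mderivD mderivZ -mul_mpolyC mderiv_cubic_of_lin expr2 !mderivM !mderiv_lin.
by congr (_ + _); ring.
Qed.

Lemma meval_mderiv_combination (K : closedFieldType) (N M a : 'I_3 -> K)
    (lambda : K) (v : 'I_3 -> K) i :
  (lin N ^+ 2 * lin a + lambda *: cubic_of_line (lin M))^`M(i).@[v] =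
  2%:R * dot N v * dot a v * N i + dot N v ^+ 2 * a i + lambda *
    (3%:R * (dot M v ^+ 2 - dot M M * dot v v) * M i
     - 6%:R * dot M M * dot M v * v i).
Proof.
rewrite mderiv_combination.
rewrite !(mevalD, mevalN, mevalM, rmorph_nat, mevalC, mevalXU, rmorphXn) /=.
by rewrite !meval_lin meval_Qiso.
Qed.

Lemma meval_combination (K : closedFieldType) (N M a : 'I_3 -> K)
    (lambda : K) (v : 'I_3 -> K) :
  (lin N ^+ 2 * lin a + lambda *: cubic_of_line (lin M)).@[v] =
  dot N v ^+ 2 * dot a v +
  lambda * ((dot M v ^+ 2 - 3%:R * dot M M * dot v v) * dot M v).
Proof.
rewrite mevalD mevalZ cubic_of_linE.
rewrite !(mevalD, mevalN, mevalM, rmorph_nat, mevalC, rmorphXn) /=.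
by rewrite !meval_lin meval_Qiso.
Qed.

(* [f] vanishes to order two at [P] and at [B], so its restriction to the line
   [PB], a binary cubic form, is zero. *)
Lemma combination_second_singular (K : closedFieldType) (N M a : 'I_3 -> K)
    (P B : 'I_3 -> K) (lambda : K) k :
  dot N P = 0 -> dot M P = 0 -> dot P P = 0 -> cross P B k != 0 ->
  let f := lin N ^+ 2 * lin a + lambda *: cubic_of_line (lin M) in
  f.@[B] = 0 -> (forall i, f^`M(i).@[B] = 0) -> mdvd (lin (cross P B)) f.
Proof.
move=> NP MP PP Sk0 f fB dB.
have [phi rphi] := line_restriction Sk0; have [phit _ phiC _ _] := rphi.
pose y i := phi 'X_i; pose C (w : 'I_3 -> K) i : {mpoly K[3]} := (w i)%:MP.
pose s := (cross P B k)^-1.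
have SE i : cross (C P) (C B) i = (cross P B i)%:MP.
  by rewrite /cross /C mpolyCB !mpolyCM.
(* [u] and [v] are the coordinates of the generic point of the line PB with respect to P and B. *)
pose u := s%:MP * cross y (C B) k; pose v := s%:MP * cross (C P) y k.
have yE i : y i = u * C P i + v * C B i.
  have /(cross_cramer k i) : dot (cross (C P) (C B)) y = 0.
    rewrite -phit (restr_lin _ rphi); apply: eq_bigr => j _.
    by rewrite SE.
  rewrite SE => /(congr1 (fun z => s%:MP * z)).
  by rewrite mulrA -mpolyCM mulVf // mpolyC1 mul1r => ->; rewrite /u /v; ring.
have linE w : phi (lin w) = u * (dot w P)%:MP + v * (dot w B)%:MP.
  rewrite (restr_lin _ rphi) /dot !(rmorph_sum (@mpolyC 3 K)) !mulr_sumr -big_split.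
  by apply: eq_bigr => i _ /=; rewrite -/(y i) yE /C !mpolyCM; ring.
have QE : phi (Qiso K) = u ^+ 2 * (dot P P)%:MP + 2%:R * u * v * (dot P B)%:MP
    + v ^+ 2 * (dot B B)%:MP.
  rewrite /Qiso rmorph_sum /dot !(rmorph_sum (@mpolyC 3 K)) !mulr_sumr -!big_split.
  by apply: eq_bigr => i _ /=; rewrite rmorphXn -/(y i) yE /C !mpolyCM; ring.
have dPB : \sum_i P i * f^`M(i).@[B] = 0.
  by rewrite big1 // => i _; rewrite dB mulr0.
apply/(restr_dvd _ rphi).
(* The terms in u^3 and u^2 v vanish since f is singular at P; those left carry f(B) and the
   derivative of f at B in direction P. *)
have -> : phi f = v ^+ 3 * (f.@[B])%:MP + u * v ^+ 2 * (\sum_i P i * f^`M(i).@[B])%:MP.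
  have -> : \sum_i P i * f^`M(i).@[B] =
      dot N B ^+ 2 * dot a P - 6%:R * lambda * dot M M * dot M B * dot P B.
    under eq_bigr do rewrite meval_mderiv_combination.
    have -> : dot N B ^+ 2 * dot a P - 6%:R * lambda * dot M M * dot M B * dot P B =
      2%:R * dot N B * dot a B * dot N P + dot N B ^+ 2 * dot a P + lambda *
      (3%:R * (dot M B ^+ 2 - dot M M * dot B B) * dot M P
       - 6%:R * dot M M * dot M B * dot P B) by rewrite NP MP; ring.
    move: (dot N B) (dot M B) (dot M M) (dot a B) (dot B B) => x1 x2 x3 x4 x5.
    by rewrite /dot !(sum3_cycle 0); ring.
  rewrite meval_combination /f -mul_mpolyC cubic_of_linE.
  rewrite !(rmorphD, rmorphN, rmorphM, rmorph_nat, rmorphXn) /=.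
  rewrite !phiC !linE QE NP MP PP mpolyC0; ring.
by rewrite fB dPB mpolyC0; ring.
Qed.

Lemma singular_combination (K : closedFieldType) (N M a : 'I_3 -> K)
    (P : 'rV[K]_3) (lambda : K) :
  P != 0 -> dot N (P ord0) = 0 -> dot M (P ord0) = 0 ->
  dot (P ord0) (P ord0) = 0 ->
  singular_at (lin N ^+ 2 * lin a + lambda *: cubic_of_line (lin M)) P.
Proof.
move=> P0 NP MP PP; split=> // [|i].
  by rewrite meval_combination NP MP; ring.
by rewrite meval_mderiv_combination NP MP PP; ring.
Qed.

Lemma combination_nodal (K : closedFieldType) (N M a : 'I_3 -> K)
    (P : 'rV[K]_3) (c lambda : K) :
  6%:R != 0 :> K -> P != 0 -> c != 0 -> (forall i, N i = c * P ord0 i) ->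
  dot (P ord0) (P ord0) = 0 -> dot M (P ord0) = 0 -> dot M M != 0 ->
  ~ (exists c, forall i, M i = c * N i) ->
  let f := lin N ^+ 2 * lin a + lambda *: cubic_of_line (lin M) in
  irreducible_form f -> nodal f /\ mdvd (lin N) (tangent_cone f P).
Proof.
move=> h6 P0 c0 NP PP MP MM ind f irr.
have hf : f \is 3.-homog by apply: combination_homog.
(* For lambda = 0 the cubic t^2 l is reducible. *)
have la0 : lambda != 0.
  apply/eqP => la0; move: irr hf.
  rewrite /f la0 scale0r addr0 expr2 -mulrA => irr hf.
  exact: (irreducible_no_factor (d := 0) (e := 1) irr (lin_homog N) hf).
have NdP : dot N (P ord0) = 0.
  by rewrite -[RHS](mulr0 c) -PP mulr_sumr; apply: eq_bigr => i _; rewrite NP mulrA.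
split; last by have [] := node_combination a h6 P0 c0 NP PP MP MM ind la0.
split=> [|B [B0 fB dB]]; first by exists P; apply: singular_combination.
have [/existsP[k]|noS] := boolP [exists k, cross (P ord0) (B ord0) k != 0].
  move=> /(combination_second_singular NdP MP PP) /(_ fB dB) [h fh].
  rewrite -/f in fh; rewrite fh in irr hf.
  by case: (irreducible_no_factor (d := 0) (e := 1) irr (lin_homog _) hf).
(* Here B represents the same projective point as P, so the node computation applies to B after
   rescaling c. *)
have cr0 i : cross (P ord0) (B ord0) i = 0.
  by apply/eqP; move: noS; rewrite negb_exists => /forallP /(_ i); rewrite negbK.
have [k Bk0] : exists k, B ord0 k != 0.
  apply/existsP; apply: contraNT B0; rewrite negb_exists => /forallP e.
  by apply/eqP/rowP => i; rewrite mxE; apply/eqP; have := e i; rewrite negbK.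
have := cross_eq0 Bk0 cr0; move: (_ / _) => e PB.
have e0 : e != 0.
  apply: contraNneq P0 => e0; apply/eqP/rowP => i.
  by rewrite mxE PB e0 mul0r.
have dotP w : dot w (P ord0) = e * dot w (B ord0).
  by rewrite /dot mulr_sumr; apply: eq_bigr => i _; rewrite PB mulrCA.
have BB : dot (B ord0) (B ord0) = 0.
  by apply: (mulfI e0); rewrite -dotP dotC; apply: (mulfI e0); rewrite -dotP PP !mulr0.
have MB : dot M (B ord0) = 0 by apply: (mulfI e0); rewrite -dotP MP mulr0.
have NB i : N i = (c * e) * B ord0 i by rewrite NP PB mulrA.
by have [] := node_combination a h6 B0 (mulf_neq0 c0 e0) NB BB MB MM ind la0.
Qed.

(** * From the geometric hypotheses to coefficient vectors *)

(** Since N is a multiple of P, passing through P means orthogonality to N; a vector orthogonal to N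
    but not a multiple of it is not isotropic. *)
Lemma tangent_line_data (K : closedFieldType) (N M : 'I_3 -> K) (P : 'rV[K]_3) :
  2%:R != 0 :> K -> lin N != 0 -> lin M != 0 ->
  tangent_at (lin N) (Qiso K) P -> ~ same_line (lin M) (lin N) ->
  (lin M).@[P ord0] = 0 ->
  [/\ dot N N = 0, dot M N = 0, dot M (P ord0) = 0, dot M M != 0
    & ~ (exists c, forall i, M i = c * N i)].
Proof.
move=> h2 /lin_neq0 [k Nk0] M0 /(tangent_at_QisoP _ _ h2) [P0 PP [c c0 NP]] nsame.
rewrite meval_lin => MP.
have dN w : dot w N = c * dot w (P ord0).
  by rewrite /dot mulr_sumr; apply: eq_bigr => i _; rewrite NP mulrCA.
have NN : dot N N = 0 by rewrite dN dotC dN PP !mulr0.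
have MN : dot M N = 0 by rewrite dN MP mulr0.
have ind : ~ exists c, forall i, M i = c * N i.
  case=> x Mx; apply/nsame/(@same_line_lin _ _ _ x) => //.
  apply: contraNneq M0 => x0; rewrite /lin big1 // => i _.
  by rewrite Mx x0 mul0r mpolyC0 mul0r.
by split=> //; apply: isotropic_norm_neq0 Nk0 NN MN ind.
Qed.

Theorem proposition6p6 (R : realType) (t : {mpoly R[i][3]}) (t_line : is_line t) :
  [/\ ~ tangent_to t (Qiso R[i]) ->
      forall f : {mpoly R[i][3]}, is_cubic f ->
        (subscheme (curve_ideal t) (eigenscheme f) <->
         exists l : {mpoly R[i][3]}, linear_form l /\ f = t ^+ 2 * l),

      forall P : 'rV[R[i]]_3, tangent_at t (Qiso R[i]) P ->
      forall r0 : {mpoly R[i][3]}, is_line r0 -> ~ same_line r0 t ->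
        r0.@[P ord0] = 0 ->
      forall f : {mpoly R[i][3]}, is_cubic f ->
        (subscheme (curve_ideal t) (eigenscheme f) <->
         exists (l : {mpoly R[i][3]}) (lambda : R[i]),
           linear_form l /\ f = t ^+ 2 * l + lambda *: cubic_of_line r0)

    & forall P : 'rV[R[i]]_3, tangent_at t (Qiso R[i]) P ->
      forall r0 : {mpoly R[i][3]}, is_line r0 -> ~ same_line r0 t ->
        r0.@[P ord0] = 0 ->
      forall f : {mpoly R[i][3]}, is_cubic f ->
        (exists (l : {mpoly R[i][3]}) (lambda : R[i]),
           linear_form l /\ f = t ^+ 2 * l + lambda *: cubic_of_line r0) ->
        singular_at f P /\
        (irreducible_form f ->
           nodal f /\ subscheme (curve_ideal t) (curve_ideal (tangent_cone f P)))].
Proof.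
have h2 : 2%:R != 0 :> R[i] by rewrite Num.Theory.pnatr_eq0.
have h3 : 3%:R != 0 :> R[i] by rewrite Num.Theory.pnatr_eq0.
have h6 : 6%:R != 0 :> R[i] by rewrite Num.Theory.pnatr_eq0.
have N0 := t_line.2; have [N tE _] := lineP t_line.
rewrite tE in N0 *; split.
- move=> ntan f [hf _]; apply: eigen_nontangent => //.
  by apply/eqP => NN; apply: ntan; apply: tangent_to_Qiso.
- move=> P tP r0 r0_line; have := r0_line.2; have [M -> _] := lineP r0_line.
  move=> M0 nsame MP f [hf _].
  have [NN MN _ _ ind] := tangent_line_data h2 N0 M0 tP nsame MP.
  exact: eigen_tangent.
move=> P tP r0 r0_line; have := r0_line.2; have [M -> _] := lineP r0_line.
move=> M0 nsame MP f _ [l [la [hl ->]]].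
rewrite (linear_formE hl); move: (fun i => _) => a.
have [NN MN MdP MM ind] := tangent_line_data h2 N0 M0 tP nsame MP.
have [P0 PP [c c0 NP]] := (tangent_at_QisoP _ _ h2).1 tP.
split.
  apply: singular_combination => //; rewrite -[RHS](mulr0 c) -PP mulr_sumr.
  by apply: eq_bigr => i _; rewrite NP mulrA.
move=> /(combination_nodal h6 P0 c0 NP PP MdP MM ind) [? [h hh]]; split=> //.
apply/(curve_subschemeP _ N0) => p [q ->]; rewrite big_ord1 hh.
by exists (q ord0 * h); rewrite mulrCA.
Qed.
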